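(* Let $\mathcal{G}$ be an ultragraph with no sinks and suppose that there exists a vertex $v$ such that $\#CP_{\mathcal{G}}(v)\geq 2$. Then the associated ultragraph shift space $X$ (with shift map $\sigma$ and metric $d_X$) is Li-Yorke chaotic. Furthermore, $X$ contains an uncountable scrambled set which is perfect and compact, as well as an uncountable scrambled set that is not closed and whose closure is not a scrambled set.
   Context: **Ultragraphs.** An ultragraph $\mathcal{G}=(G^0,\mathcal{G}^1,r,s)$ consists of two countable sets $G^0$ (vertices) and $\mathcal{G}^1$ (edges), a map $s:\mathcal{G}^1\to G^0$ and a map $r:\mathcal{G}^1\to P(G^0)\setminus\{\emptyset\}$, where $P(G^0)$ is the power set of $G^0$. $\mathcal{G}^0$ is the smallest subset of $P(G^0)$ that contains $\{v\}$ for all $v\in G^0$, contains $r(e)$ for all $e\in\mathcal{G}^1$, and is closed under finite unions and nonempty finite intersections. A vertex $v$ is a sink if $s^{-1}(v)=\emptyset$. **Paths.** A finite path of length $k\ge 1$ is a sequence of edges $\alpha=e_1\ldots e_k$ with $s(e_{i+1})\in r(e_i)$; $s(\alpha)=s(e_1)$, $r(\alpha)=r(e_k)$. Elements $A\in\mathcal{G}^0$ are finite paths of length $0$ with $s(A)=r(A)=A$. An infinite path is an infinite sequence of edges $\gamma=e_1e_2\ldots$ with $s(e_{i+1})\in r(e_i)$ for all $i$; $s(\gamma)=s(e_1)$; the set of these is $\mathfrak{p}^\infty$. For $n\ge1$, $\mathfrak{p}^n$ is the set of pairs $(\alpha,A)$ with $\alpha$ a finite path of length $n$, $A\in\mathcal{G}^0$,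 $A\subseteq r(\alpha)$; $\mathfrak{p}^0=\mathcal{G}^0$ ($A$ is identified with $(A,A)$); $\mathfrak{p}=\coprod_{n\ge0}\mathfrak{p}^n$ (a countable set). Put $|(\alpha,A)|=|\alpha|$, $r((\alpha,A))=A$, $s((\alpha,A))=s(\alpha)$. A path $\alpha$ is identified with $(\alpha,r(\alpha))$. **Concatenation and initial segments.** For $(\alpha,A),(\beta,B)$ of length $\ge1$ with $s(\beta)\in A$, $(\alpha,A)\cdot(\beta,B)=(\alpha\beta,B)$. For $A,B\in\mathcal{G}^0$ with $A\cap B\ne\emptyset$, $A\cdot B=A\cap B$. For $A\in\mathcal{G}^0$ and $|y|\ge1$ with $s(y)\in A$, $A\cdot y=y$. For $x=(\alpha,A)$ with $|\alpha|\ge1$ and $B\in\mathcal{G}^0$ with $A\cap B\neq\emptyset$, $x\cdot B=(\alpha,A\cap B)$. For $\gamma\in\mathfrak{p}^\infty$ with $s(\gamma)\in A$: $(\alpha,A)\cdot\gamma=\alpha\gamma$ and $A\cdot\gamma=\gamma$. An element $y\in\mathfrak{p}$ is an initial segment of $x\in\mathfrak{p}\cup\mathfrak{p}^\infty$ if $x=y\cdot x'$ for some $x'\in\mathfrak{p}\cup\mathfrak{p}^\infty$ for which this product is defined. **Shift space.** For $A\subseteq G^0$, $\varepsilon(A)=\{e\in\mathcal{G}^1:s(e)\in A\}$. $A\in\mathcal{G}^0$ is an infinite emitter if $\varepsilon(A)$ is infinite, and a minimal infinite emitter if moreover no proper subset of $A$ belonging to $\mathcal{G}^0$ is an infinite emitter.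 $M_\alpha$ is the set of minimal infinite emitters contained in $r(\alpha)$. For an ultragraph with no sinks, $X=\mathfrak{p}^\infty\cup X_{fin}$ with $X_{fin}=\{(\alpha,A)\in\mathfrak{p}:|\alpha|\ge1,A\in M_\alpha\}\cup\{(A,A):A\text{ a minimal infinite emitter}\}$. The shift map $\sigma:X\to X$ is $\sigma(\gamma_1\gamma_2\ldots)=\gamma_2\gamma_3\ldots$, $\sigma((\gamma_1\ldots\gamma_n,A))=(\gamma_2\ldots\gamma_n,A)$ if $n>1$, $\sigma((\gamma_1,A))=(A,A)$, $\sigma((A,A))=(A,A)$. **Metric.** Fix an enumeration $\mathfrak{p}=\{p_1,p_2,\ldots\}$ (arbitrary). $d_X(x,x)=0$ and, for $x\neq y$, $d_X(x,y)=1/2^i$ where $i$ is the smallest index such that $p_i$ is an initial segment of one of $x,y$ but not of the other. Topological notions in $X$ refer to the topology induced by $d_X$ (which is the topology of $X$). **Chaos.** A pair $x,y\in X$ is scrambled if $\limsup_{n}d_X(\sigma^n(x),\sigma^n(y))>0$ and $\liminf_{n}d_X(\sigma^n(x),\sigma^n(y))=0$. A set is scrambled if every pair of distinct elements of it is scrambled; $X$ is Li-Yorke chaotic if it has an uncountable scrambled set. Perfect means closed and without isolated points. **Closed paths.** A closed path based at the vertex $v$ is a finite path $e_1e_2\ldots e_k$ ($k\ge1$) such that $v=s(e_1)\in r(e_k)$ and $s(e_i)\ne v$ for all $i>1$. $CP_{\mathcal{G}}(v)$ is the set of all closed paths based at $v$. *)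

(* Defs.v *)
From HB Require Import structures.
From mathcomp Require Import all_boot all_order all_algebra.
From mathcomp Require Import all_classical all_reals all_analysis.

Set Implicit Arguments.
Unset Strict Implicit.
Unset Printing Implicit Defensive.

Import Order.TTheory GRing.Theory Num.Theory.

Local Open Scope classical_set_scope.
Local Open Scope ring_scope.

Record ultragraph := Ultragraph {
  vertex : countType;
  edge : countType;
  src : edge -> vertex;
  rng : edge -> set vertex;
  rng_neq0 : forall e, rng e !=set0 }.

Section Ultragraph.
Variable G : ultragraph.
Implicit Types (A B : set (vertex G)) (a : seq (edge G)).

(* The family of generalized vertices.  "Nonempty finite intersections" is
   read as: intersections that are nonempty sets; so set0 is not a member. *)
Inductive gvertex : set (vertex G) -> Prop :=
  | gvertex_set1 v : gvertex [set v]
  | gvertex_rng e : gvertex (rng e)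
  | gvertex_setU A B : gvertex A -> gvertex B -> gvertex (A `|` B)
  | gvertex_setI A B : gvertex A -> gvertex B -> A `&` B !=set0 ->
      gvertex (A `&` B).

Definition sink (v : vertex G) : Prop := @src G @^-1` [set v] = set0.

Definition no_sinks : Prop := forall v : vertex G, ~ sink v.

Definition composable : rel (edge G) := fun e f => src f \in rng e.

(* [Fin a A] is the pair (a, A); [Fin [::] A] is the path A = (A, A) of
   length 0. *)
Inductive gpath :=
  | Fin of seq (edge G) & set (vertex G)
  | Inf of nat -> edge G.

HB.instance Definition _ := gen_eqMixin gpath.
HB.instance Definition _ := gen_choiceMixin gpath.

Definition fin_paths : set gpath := [set x | if x is Fin a A then
  [/\ gvertex A, sorted composable a &
      if a is e :: a' then A `<=` rng (last e a') else True]
  else False].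

Definition inf_paths : set gpath := [set x | if x is Inf g then
  forall n, composable (g n) (g n.+1) else False].

(* The product (a, A) . x is defined iff [starts_in A x]; its value is then
   [concat a A x], which covers all cases (a empty or not, x in G^0, of
   positive finite length, or infinite). *)
Definition starts_in A (x : gpath) : Prop :=
  match x with
  | Fin [::] B => A `&` B !=set0
  | Fin (e :: _) _ => A (src e)
  | Inf g => A (src (g 0%N))
  end.

Definition icat a (g : nat -> edge G) : nat -> edge G :=
  fun n => if (n < size a)%N then nth (g 0%N) a n else g (n - size a)%N.

Definition concat a A (x : gpath) : gpath :=
  match x with
  | Fin [::] B => Fin a (A `&` B)
  | Fin b B => Fin (a ++ b) B
  | Inf g => Inf (icat a g)
  end.

Definition initial_segment (y x : gpath) : Prop :=
  if y is Fin a A then exists x',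
    [/\ (fin_paths `|` inf_paths) x', starts_in A x' & x = concat a A x']
  else False.

Definition emission A : set (edge G) := [set e | A (src e)].

Definition infinite_emitter A : Prop :=
  gvertex A /\ infinite_set (emission A).

Definition minimal_infinite_emitter A : Prop :=
  infinite_emitter A /\
  forall B, gvertex B -> B `<` A -> ~ infinite_emitter B.

Definition Xfin : set gpath := [set x | fin_paths x /\
  if x is Fin a A then minimal_infinite_emitter A else False].

Definition X : set gpath := inf_paths `|` Xfin.

(* [behead] fixes [::], and sends [:: e] to [::], as (e, A) is sent to (A, A). *)
Definition shift_gpath (x : gpath) : gpath :=
  match x with
  | Inf g => Inf (fun n => g n.+1)
  | Fin a A => Fin (behead a) A
  end.

Lemma shift_gpath_subproof (x : X) : shift_gpath (val x) \in X.
Proof.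
case: x => x /= /set_mem xX; apply/mem_set.
case: x xX => [a A|g] [|].
- by [].
- move=> [[gA sa aA] mA]; right; split => //=; split => //.
    by case: a sa {aA} => //= e a; exact: path_sorted.
  by case: a aA {sa} => //= e [].
- by move=> gP; left => n; exact: gP.
- by case.
Qed.

Definition closed_paths (v : vertex G) : set (seq (edge G)) :=
  [set a | if a is e :: a' then
     [/\ path composable e a', v = src e, rng (last e a') v &
         forall f, f \in a' -> src f != v]
   else False].

(* Listings p_1, p_2, ... of the finite paths: [p i] stands for p_(i+1).
   Repetitions are allowed. *)
Record enumeration := Enumeration {
  enum_fun :> nat -> gpath;
  enum_range : range enum_fun = fin_paths }.

Definition separates (y x1 x2 : gpath) : Prop :=
  (initial_segment y x1 /\ ~ initial_segment y x2) \/
  (~ initial_segment y x1 /\ initial_segment y x2).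

Lemma separatesC y x1 x2 : separates y x1 x2 -> separates y x2 x1.
Proof. by move=> [[]|[]]; [right|left]. Qed.

Lemma separatesxx y x : ~ separates y x x.
Proof. by move=> [[]|[]]. Qed.

Lemma separates_trans y x1 x2 x3 :
  separates y x1 x3 -> separates y x1 x2 \/ separates y x2 x3.
Proof. by have := EM (initial_segment y x2); rewrite /separates; tauto. Qed.

Lemma initial_segment_self a A : fin_paths (Fin a A) -> A !=set0 ->
  initial_segment (Fin a A) (Fin a A).
Proof.
move=> [gA _ _] A0; exists (Fin [::] A); split => /=; rewrite ?setIid//.
by left.
Qed.

Lemma fin_paths_prefix (g : nat -> edge G) n : inf_paths (Inf g) ->
  fin_paths (Fin (mkseq g n.+1) (rng (g n))).
Proof.
move=> gP; split; first exact: gvertex_rng.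
- have H m k : path composable (g m) (map g (iota m.+1 k)).
    by elim: k m => //= k IH m; rewrite IH andbT; exact: gP.
  exact: H.
- rewrite /= (last_map g (iota 1 n) 0%N).
  have H m k : last m (iota m.+1 k) = (m + k)%N.
    by elim: k m => [|k IH] m /=; rewrite ?addn0// IH addnS.
  by rewrite H.
Qed.

Lemma icat_prefix (g : nat -> edge G) n :
  icat (mkseq g n) (fun k => g (n + k)%N) = g.
Proof.
apply/funext => k; rewrite /icat size_mkseq; case: ltnP => kn.
  by rewrite nth_mkseq.
by rewrite subnKC.
Qed.

Lemma initial_segment_prefix (g : nat -> edge G) n : inf_paths (Inf g) ->
  initial_segment (Fin (mkseq g n.+1) (rng (g n))) (Inf g).
Proof.
move=> gP; exists (Inf (fun k => g (n.+1 + k)%N)); split.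
- by right=> k /=; rewrite addnS; exact: gP.
- by rewrite /= addn0; have /set_mem := gP n.
- by rewrite /= icat_prefix.
Qed.

Lemma initial_segment_size a A b B :
  initial_segment (Fin a A) (Fin b B) -> (size a <= size b)%N.
Proof.
move=> [[[|e c] C|g] [_ _]] //= [-> _] //.
by rewrite size_cat leq_addr.
Qed.

Lemma initial_segment_sub a A B :
  initial_segment (Fin a A) (Fin a B) -> B `<=` A.
Proof.
move=> [[[|e c] C|g] [_ _]] //=; first by move=> [->].
by move=> [/(congr1 size)/eqP]; rewrite size_cat -[X in X == _]addn0 eqn_add2l.
Qed.

Lemma initial_segment_Fin a A b B :
  initial_segment (Fin a A) (Fin b B) -> a = take (size a) b.
Proof.
move=> [[[|e c] C|g] [_ _]] //= [-> _]; first by rewrite take_size.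
by rewrite take_size_cat.
Qed.

Lemma initial_segment_nth a A g h n : (n < size a)%N ->
  initial_segment (Fin a A) (Inf g) -> nth (h 0%N) a n = g n.
Proof.
move=> na [[[|e c] C|k] [_ _]] //= [->]; rewrite /icat na.
exact: set_nth_default.
Qed.

Lemma X_separated x1 x2 : X x1 -> X x2 -> x1 <> x2 ->
  exists2 y, fin_paths y & separates y x1 x2.
Proof.
move=> X1 X2 x12; apply: contrapT => nsep.
have iE y : fin_paths y -> (initial_segment y x1 <-> initial_segment y x2).
  move=> yP; have : ~ separates y x1 x2 by move=> ?; apply: nsep; exists y.
  rewrite /separates.
  by have := EM (initial_segment y x1); have := EM (initial_segment y x2); tauto.
have X0 a A : X (Fin a A) -> fin_paths (Fin a A) /\ A !=set0.
  move=> [//|[aP /= [[_ infA] _]]]; split=> //; apply/set0P/eqP => A0.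
  by apply: infA; rewrite A0; exact: finite_set0.
have XFI a A g : X (Fin a A) -> X (Inf g) ->
    ~ (forall y, fin_paths y ->
        (initial_segment y (Fin a A) <-> initial_segment y (Inf g))).
  move=> _ [gP|[]//] /(_ _ (fin_paths_prefix (size a) gP))[_].
  move=> /(_ (initial_segment_prefix (size a) gP)) /initial_segment_size.
  by rewrite size_mkseq ltnn.
case: x1 x2 X1 X2 x12 iE {nsep} => [a A|g] [b B|h] X1 X2 x12 iE.
- have [aP A0] := X0 _ _ X1; have [bP B0] := X0 _ _ X2.
  have i12 := (iE _ aP).1 (initial_segment_self aP A0).
  have i21 := (iE _ bP).2 (initial_segment_self bP B0).
  have ab : size a = size b.
    by apply/eqP; rewrite eqn_leq (initial_segment_size i12) (initial_segment_size i21).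
  have eab : a = b by rewrite (initial_segment_Fin i12) ab take_size.
  subst b; apply: x12; congr Fin; apply/seteqP; split.
    exact: initial_segment_sub i21.
  exact: initial_segment_sub i12.
- exact: XFI X1 X2 iE.
- by apply: XFI X2 X1 _ => y /iE H; split => /H.
- case: X1 => [gP|[]//]; apply: x12; congr Inf; apply/funext => n.
  have := (iE _ (fin_paths_prefix n gP)).1 (initial_segment_prefix n gP).
  move=> /(@initial_segment_nth _ _ _ g n); rewrite size_mkseq ltnSn nth_mkseq//.
  exact.
Qed.

End Ultragraph.

Arguments fin_paths G : clear implicits.
Arguments inf_paths G : clear implicits.
Arguments Xfin G : clear implicits.
Arguments X G : clear implicits.

Section Metric.
Variables (R : realType) (G : ultragraph) (p : enumeration G).

Lemma enum_separates (x1 x2 : X G) : x1 <> x2 ->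
  exists i, `[< separates (p i) (val x1) (val x2) >].
Proof.
move=> x12; have nval : val x1 <> val x2 by move=> /val_inj.
have [y yP ys] := X_separated (set_valP x1) (set_valP x2) nval.
have : range p y by rewrite enum_range.
by move=> [i _ iy]; exists i; apply/asboolP; rewrite iy.
Qed.

(* [p i] is the (i+1)-st path, hence the exponent i.+1. *)
Definition dX (x1 x2 : X G) : R :=
  match pselect (x1 = x2) with
  | left _ => 0
  | right x12 => 2^-1 ^+ (ex_minn (enum_separates x12)).+1
  end.

Lemma dXP (x1 x2 : X G) i :
  separates (p i) (val x1) (val x2) ->
  (forall j, (j < i)%N -> ~ separates (p j) (val x1) (val x2)) ->
  dX x1 x2 = 2^-1 ^+ i.+1.
Proof.
move=> si mi; rewrite /dX; case: pselect => [e|x12].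
  by move: si; rewrite e => /separatesxx.
case: ex_minnP => j /asboolP sj mj; congr (_ ^+ _.+1); apply/eqP.
rewrite eqn_leq mj/=; last exact/asboolP.
by rewrite leqNgt; apply/negP => /mi; exact.
Qed.

Lemma dXxx x : dX x x = 0.
Proof. by rewrite /dX; case: pselect. Qed.

Lemma dX_neq (x1 x2 : X G) : x1 <> x2 -> exists i,
  [/\ separates (p i) (val x1) (val x2),
      forall j, (j < i)%N -> ~ separates (p j) (val x1) (val x2) &
      dX x1 x2 = 2^-1 ^+ i.+1].
Proof.
move=> x12; pose i := ex_minn (enum_separates x12).
have [si mi] : separates (p i) (val x1) (val x2) /\
    forall j, (j < i)%N -> ~ separates (p j) (val x1) (val x2).
  rewrite /i; case: ex_minnP => j /asboolP sj mj; split=> // k kj /asboolP/mj.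
  by rewrite leqNgt kj.
by exists i; split=> //; exact: dXP.
Qed.

Lemma dX_positivity x1 x2 : dX x1 x2 = 0 -> x1 = x2.
Proof.
move=> d0; apply: contrapT => /dX_neq[i [_ _]]; rewrite d0 => /esym/eqP.
by rewrite expf_eq0 /= invr_eq0 pnatr_eq0.
Qed.

Lemma dX_sym x1 x2 : dX x1 x2 = dX x2 x1.
Proof.
have [->//|/eqP/dX_neq[i [si mi ->]]] := eqVneq x1 x2.
apply/esym/dXP; first exact: separatesC.
by move=> j /mi + /separatesC.
Qed.

Lemma dX_ge0 x1 x2 : 0 <= dX x1 x2.
Proof. by have [->|/eqP/dX_neq[i [_ _ ->]]] := eqVneq x1 x2; rewrite ?dXxx. Qed.

Lemma dX_le (x1 x2 : X G) i : separates (p i) (val x1) (val x2) ->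
  2^-1 ^+ i.+1 <= dX x1 x2.
Proof.
move=> si; have [e|/eqP/dX_neq[j [sj mj ->]]] := eqVneq x1 x2.
  by move: si; rewrite e => /separatesxx.
apply: ler_wiXn2l; rewrite ?invr_ge0 ?invf_le1 ?ler1n// ltnS leqNgt.
by apply/negP => /mj; exact.
Qed.

Lemma dX_triangle x2 x1 x3 : dX x1 x3 <= dX x1 x2 + dX x2 x3.
Proof.
have [->|/eqP/dX_neq[i [si _ ->]]] := eqVneq x1 x3.
  by rewrite dXxx addr_ge0 ?dX_ge0.
by case: (separates_trans (val x2) si) => /dX_le/le_trans; apply;
  rewrite ?lerDl ?lerDr dX_ge0.
Qed.

End Metric.

(* The parameters R and p only select the metric [dX R p]. *)
Definition shift_space (R : realType) (G : ultragraph) (p : enumeration G) :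
  Type := X G.

Section ShiftSpace.
Variables (R : realType) (G : ultragraph) (p : enumeration G).

HB.instance Definition _ := Choice.on (shift_space R p).
HB.instance Definition _ := @isMetric.Build R (shift_space R p) (@dX R G p)
  (@dXxx R G p) (@dX_positivity R G p) (@dX_sym R G p) (@dX_triangle R G p).

Definition shift_map (x : shift_space R p) : shift_space R p :=
  SigSub (shift_gpath_subproof x).

End ShiftSpace.

Section LiYorke.
Variables (R : realType) (T : metricType R) (f : T -> T).

Definition scrambled_pair (x y : T) : Prop :=
  let u : R^nat := fun n => mdist (iter n f x) (iter n f y) in
  0 < limn_sup u /\ limn_inf u = 0.

Definition scrambled_set (S : set T) : Prop :=
  forall x y, S x -> S y -> x <> y -> scrambled_pair x y.

Definition li_yorke_chaotic : Prop :=
  exists S : set T, ~ countable S /\ scrambled_set S.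

End LiYorke.

(* Main.v *)
Require Import Defs.
From mathcomp Require Import all_boot all_order all_algebra.
From mathcomp Require Import all_classical all_reals all_analysis.

(** Two distinct closed paths [a] and [b] at [v] can be juxtaposed in any order.
The words [ab] and [ba] have the same length [L], and they are distinct since
the closed path being run through can be read off from the visits to [v]
([closed_paths_cat_neq]).  So the binary sequences parametrize infinite paths
made of these two blocks, one shift of a binary sequence corresponding to [L]
shifts of the path.

On infinite paths the distance compares beginnings: a listed path tests only
finitely many edges, and every finite beginning is tested by a listed path
([dX_lt_agree], [dX_lt_prefix]).  The parametrization is therefore a uniformly
continuous copy of the full shift on two symbols inside the [L]-th iterate of
the shift map ([juxtapose_coding]), and the rest takes place in the full shift.

There, two sequences form a scrambled pair as soon as they differ at infinitely
many positions and agree on arbitrarily long windows ([coding_scrambled]).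
Copying each bit of [c] at infinitely many positions that get sparser and
sparser, with zeros elsewhere, turns any two distinct sequences into such a pair
([sparse]).  The resulting map from the Cantor space is continuous and
injective, and its image is an uncountable scrambled set which is compact and
perfect because the Cantor space is ([range_psi_perfect_compact]).

Finally, replacing one point of this perfect set by another point with the same
future keeps it scrambled, but leaves the replaced point in the closure, where
it makes with its substitute a pair that is not scrambled
([replace_perfect_scrambled]). *)

Set Implicit Arguments.
Unset Strict Implicit.
Unset Printing Implicit Defensive.

Import Order.TTheory GRing.Theory Num.Theory.
Import numFieldNormedType.Exports.

Local Open Scope classical_set_scope.
Local Open Scope ring_scope.

(** * Limits superior and inferior of real sequences *)

Lemma sdrop_shift (T : Type) (u : nat -> T) N n :
  sdrop (fun k => u (k + N)%N) n = sdrop u (n + N)%N.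
Proof.
apply/seteqP; split => _ [k /= nk <-].
  by exists (k + N)%N => //=; rewrite leq_add2r.
have Nk : (N <= k)%N by rewrite (leq_trans _ nk)// leq_addl.
by exists (k - N)%N => /=; rewrite ?subnK// leq_subRL// addnC.
Qed.

Lemma limn_sup_shift (R : realType) (u : R^nat) N :
  limn_sup (fun n => u (n + N)%N) = limn_sup u.
Proof.
rewrite /limn_sup (_ : sups _ = [sequence sups u (n + N)%N]_n).
  by congr get; apply/funext => l; exact: (cvg_shiftn N _ (nbhs l)).
by apply/funext => n; congr sup; exact: sdrop_shift.
Qed.

Lemma limn_inf_shift (R : realType) (u : R^nat) N :
  limn_inf (fun n => u (n + N)%N) = limn_inf u.
Proof.
rewrite /limn_inf (_ : infs _ = [sequence infs u (n + N)%N]_n).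
  by congr get; apply/funext => l; exact: (cvg_shiftn N _ (nbhs l)).
by apply/funext => n; congr inf; exact: sdrop_shift.
Qed.

Lemma limn_sup_ge_frequently (R : realType) (u : R^nat) (M c : R) :
  (forall n, 0 <= u n <= M) ->
  (forall N, exists2 n, (N <= n)%N & c <= u n) -> c <= limn_sup u.
Proof.
move=> uM uc.
have ub : has_ubound (range u) by exists M => _ [n _ <-]; case/andP: (uM n).
have lb : has_lbound (range u) by exists 0 => _ [n _ <-]; case/andP: (uM n).
have -> : limn_sup u = inf (range (sups u)).
  by apply/cvg_lim => //; exact: cvg_sups_inf.
apply: lb_le_inf; first by exists (sups u 0%N); exists 0%N.
move=> _ [n _ <-]; have [m nm /le_trans] := uc n; apply.
by apply: ub_le_sup; [exact: has_ubound_sdrop|exists m].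
Qed.

Lemma limn_inf_eq0_frequently (R : realType) (u : R^nat) (M : R) :
  (forall n, 0 <= u n <= M) ->
  (forall e, 0 < e -> forall N, exists2 n, (N <= n)%N & u n < e) ->
  limn_inf u = 0.
Proof.
move=> uM ue.
have ub : has_ubound (range u) by exists M => _ [n _ <-]; case/andP: (uM n).
have lb : has_lbound (range u) by exists 0 => _ [n _ <-]; case/andP: (uM n).
have infs0 n : infs u n = 0.
  apply/eqP; rewrite eq_le; apply/andP; split.
    apply/ler_addgt0Pr => e e0; rewrite add0r.
    have [m nm /ltW] := ue _ e0 n; apply: le_trans.
    by apply: ge_inf; [exact: has_lbound_sdrop|exists m].
  apply: lb_le_inf; first by exists (u n); exists n => /=.
  by move=> _ [m _ <-]; case/andP: (uM m).
rewrite /limn_inf (_ : infs u = cst 0) ?lim_cst//.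
exact/funext.
Qed.

(** * Scrambled pairs in a dynamical system *)

Lemma scrambled_pair_iter (R : realType) (T : metricType R) (f : T -> T) N x y :
  scrambled_pair f (iter N f x) (iter N f y) <-> scrambled_pair f x y.
Proof.
rewrite /scrambled_pair; pose u n := mdist (iter n f x) (iter n f y).
have -> : (fun n => mdist (iter n f (iter N f x)) (iter n f (iter N f y))) =
  (fun n => u (n + N)%N) by apply/funext => n; rewrite /u -!iterD.
by rewrite limn_sup_shift limn_inf_shift.
Qed.

Lemma not_scrambled_pairxx (R : realType) (T : metricType R) (f : T -> T) x :
  ~ scrambled_pair f x x.
Proof.
rewrite /scrambled_pair => -[+ _]; rewrite cvg_limn_supE.
- under eq_fun do rewrite mdistxx; rewrite lim_cst// ltxx//.
- under eq_fun do rewrite mdistxx; exact: is_cvg_cst.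
Qed.

Lemma scrambled_pairC (R : realType) (T : metricType R) (f : T -> T) x y :
  scrambled_pair f x y -> scrambled_pair f y x.
Proof. by rewrite /scrambled_pair; under eq_fun do rewrite metric_sym. Qed.

(** Being scrambled depends only on the tails of the two orbits, so a point [s]
of a scrambled set may be traded for any other point [t] whose orbit eventually
merges with that of [s]. The pair [t, s] itself is not scrambled; when the
original set is perfect, [s] stays in the closure after the trade, and this one
bad pair shows both that the closure is not scrambled and that the new set is
not closed. *)
Lemma replace_perfect_scrambled (R : realType) (T : metricType R) (f : T -> T)
    (S : set T) s t N :
  ~ countable S -> scrambled_set f S -> perfect_set S -> S s ->
  t <> s -> iter N f t = iter N f s ->
  exists S' : set T, [/\ ~ countable S', scrambled_set f S',
    ~ closed S' & ~ scrambled_set f (closure S')].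
Proof.
move=> uS scS [_ lS] Ss ts Nts; pose S' := S `\ s `|` [set t].
have nst : ~ scrambled_pair f t s.
  by rewrite -(scrambled_pair_iter f N) Nts; exact: not_scrambled_pairxx.
have scS' : scrambled_set f S'.
  have tS y : S y -> y <> s -> scrambled_pair f t y.
    move=> Sy ys; rewrite -(scrambled_pair_iter f N) Nts scrambled_pair_iter.
    by apply: scS => // /esym.
  move=> x y [[Sx xs]|->] [[Sy ys]|->] xy //.
  - exact: scS.
  - exact/scrambled_pairC/tS.
  - exact: tS.
have ncl : ~ scrambled_set f (closure S').
  move=> /(_ t s); apply/not_implyP; split.
    by apply: subset_closure; right.
  apply/not_implyP; split.
    move=> U Us; have : limit_point S s by rewrite lS.
    by move=> /(_ U Us)[y [/eqP ys Sy Uy]]; exists y; split=> //; left.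
  by move=> /(_ ts).
exists S'; split=> //.
  (* [S] is the image of [S'] under sending [t] back to [s] *)
  move=> cS'; apply: uS; pose g x := if x == t then s else x.
  apply: sub_countable (sub_countable (card_image_le g S') cS').
  apply: subset_card_le => x Sx; have [->|/eqP xs] := eqVneq x s.
    by exists t; [right|rewrite /g eqxx].
  exists x; first by left.
  by rewrite /g; case: eqP => // xt; case: nst; apply: scS; rewrite -?xt.
by move=> cS'; apply: ncl; rewrite -(closure_id S').1.
Qed.

(** * Spreading a binary sequence over sparse positions *)

(** The marked positions are the powers of 2, and [2 ^ m] carries the label
[logn 2 m]: every label recurs forever, since [m] may be [2 ^ k] times any odd
number, while the unmarked stretches between consecutive powers of 2 become
arbitrarily long. *)
Definition mark (n : nat) : option nat :=
  if n == (2 ^ logn 2 n)%N then Some (logn 2 (logn 2 n)) else None.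

Lemma mark_recurrent k N : exists2 n, (N <= n)%N & mark n = Some k.
Proof.
pose m := (2 ^ k * N.*2.+1)%N; exists (2 ^ m)%N.
  rewrite (leq_trans _ (ltnW (ltn_expl m (isT : 1 < 2)%N)))//.
  rewrite (@leq_trans N.*2.+1)// ?leq_pmull ?expn_gt0//.
  by rewrite -addnn -addSn leq_addl.
rewrite /mark pfactorK// eqxx lognM ?expn_gt0// pfactorK//.
by rewrite logn_coprime ?addn0// coprime2n /= odd_double.
Qed.

Lemma mark_gap l N :
  exists2 n, (N <= n)%N & forall i, (i < l)%N -> mark (n + i) = None.
Proof.
pose m := (N + l)%N; exists (2 ^ m).+1.
  rewrite ltnW// ltnS (leq_trans _ (ltnW (ltn_expl m (isT : 1 < 2)%N)))//.
  exact: leq_addr.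
move=> i il; rewrite /mark; case: eqP => // /esym; set j := logn _ _ => nE.
have lo : (2 ^ m < 2 ^ j)%N by rewrite nE addSn ltnS leq_addr.
have hi : (2 ^ j < 2 ^ m.+1)%N.
  rewrite nE expnS mul2n -addnn addSn -addnS ltn_add2l (leq_ltn_trans il)//.
  by rewrite (leq_trans (ltn_expl l (isT : 1 < 2)%N))// leq_exp2l// leq_addl.
move: lo hi; rewrite !ltn_exp2l// ltnS => /leq_trans h /h.
by rewrite ltnn.
Qed.

(** The label of a position tells which bit of [c] is copied there. Each
difference between [c] and [c'] is thus repeated infinitely often, and yet
[sparse c] and [sparse c'] agree on arbitrarily long windows: these two
features are what makes a pair scrambled for the shift. *)
Definition sparse (c : nat -> bool) (n : nat) : bool :=
  if mark n is Some k then c k else false.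

Lemma sparse_neq c c' N : c <> c' ->
  exists2 n, (N <= n)%N & sparse c n != sparse c' n.
Proof.
move=> cc'; have [k ck] : exists k, c k != c' k.
  apply: contrapT => h; apply: cc'; apply/funext => k.
  by apply/eqP/negPn/negP => ck; apply: h; exists k.
by have [n Nn nk] := mark_recurrent k N; exists n => //; rewrite /sparse nk.
Qed.

Lemma sparse_eq c c' l N :
  exists2 n, (N <= n)%N &
    forall i, (i < l)%N -> sparse c (n + i) = sparse c' (n + i).
Proof.
have [n Nn gap] := mark_gap l N; exists n => // i il.
by rewrite /sparse gap.
Qed.

(** * The Cantor space *)

Lemma uncountable_cantor : ~ countable [set: nat -> bool].
Proof.
move=> /countable_injP[g gi].
(* Cantor's diagonal: [d] disagrees with itself at its own index [g d] *)
pose d n := `[< exists c, g c = n /\ c n = false >].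
have : d (g d) = ~~ d (g d).
  apply/asboolP/idP => [[c [/gi]]|/negbTE nd]; last by exists d.
  by rewrite !inE => /(_ I I) -> ->.
by case: (d _).
Qed.

Lemma near_cantor_coord (c : cantor_space) k :
  \forall c' \near c, c' k = c k.
Proof.
have := @proj_continuous _ (fun _ : nat => bool) k c [set c k].
by apply; exact: discrete_set1.
Qed.

(** * Systems that code the full shift on two symbols *)

(** The map [phi] embeds the full shift on two symbols into an iterate of [f].
The second condition is uniform continuity for the product topology, the third
a uniform form of expansiveness. *)
Definition shift_coding (R : realType) (T : metricType R) (f : T -> T) (L : nat)
    (phi : (nat -> bool) -> T) : Prop :=
  [/\ forall w, iter L f (phi w) = phi (fun n => w n.+1),
      forall e : R, 0 < e -> exists N, forall w w',
        (forall n, (n < N)%N -> w n = w' n) -> mdist (phi w) (phi w') < e &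
      exists2 e : R, 0 < e &
        forall w w', w 0%N != w' 0%N -> e <= mdist (phi w) (phi w')].

Section Coding.
Variables (R : realType) (T : metricType R) (f : T -> T) (L : nat).
Variables (phi : (nat -> bool) -> T) (M : R).
Hypotheses (L0 : (0 < L)%N) (bounded : forall x y : T, mdist x y <= M).
Hypothesis coding : shift_coding f L phi.

Lemma coding_iter k w : iter (k * L) f (phi w) = phi (fun n => w (k + n)%N).
Proof.
have [shift _ _] := coding.
elim: k w => [//|k IH] w; rewrite mulSn addnC iterD shift IH.
by congr phi; apply/funext => n; rewrite addSnnS.
Qed.

(** At time [n * L] the two orbits sit at the codes of the sequences shifted by
[n]: a difference at position [n] keeps them uniformly apart, and a long common
window starting at [n] brings them close. The bound [M] matters, as [limn_sup]
is a real number and is meaningful for bounded sequences only. *)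
Lemma coding_scrambled w w' :
  (forall N, exists2 n, (N <= n)%N & w n != w' n) ->
  (forall l N, exists2 n, (N <= n)%N &
     forall i, (i < l)%N -> w (n + i)%N = w' (n + i)%N) ->
  scrambled_pair f (phi w) (phi w').
Proof.
move=> dif agr; have [_ cont [c c0 sep]] := coding.
have uM n : 0 <= mdist (iter n f (phi w)) (iter n f (phi w')) <= M.
  by rewrite mdist_ge0 bounded.
split.
  apply: (lt_le_trans c0); apply: limn_sup_ge_frequently uM _ => N.
  have [n Nn wn] := dif N; exists (n * L)%N.
    by rewrite (leq_trans Nn)// leq_pmulr.
  by rewrite !coding_iter; apply: sep; rewrite addn0.
apply: limn_inf_eq0_frequently uM _ => e /cont[l phil] N.
have [n Nn wn] := agr l N; exists (n * L)%N.
  by rewrite (leq_trans Nn)// leq_pmulr.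
by rewrite !coding_iter; exact: phil.
Qed.

Let psi (c : cantor_space) : T := phi (sparse c).

Lemma scrambled_pair_sparse c c' : c <> c' ->
  scrambled_pair f (psi c) (psi c').
Proof.
move=> cc'; apply: coding_scrambled => [N|l N]; first exact: sparse_neq.
exact: sparse_eq.
Qed.

Lemma psi_inj : injective psi.
Proof.
move=> c c' cc'; apply: contrapT => /scrambled_pair_sparse; rewrite cc'.
exact: not_scrambled_pairxx.
Qed.

(** Up to any [e], the point [psi c] is determined by finitely many terms of
[sparse c], hence by the finitely many bits of [c] that label these positions.
*)
Lemma continuous_psi : continuous psi.
Proof.
move=> c; apply/cvg_ballP => e e0.
have [_ /(_ e e0)[N phiN] _] := coding.
have H : \forall c' \near c, forall n, (n < N)%N -> sparse c n = sparse c' n.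
  elim: N {phiN} => [|N IH]; first by near=> c'.
  have H : \forall c' \near c, sparse c N = sparse c' N.
    rewrite /sparse; case: (mark N) => [k|]; last by near=> c'.
    by apply: filterS (near_cantor_coord c k) => c' ->.
  apply: filterS2 IH H => c' h1 h2 n.
  by rewrite ltnS leq_eqVlt => /orP[/eqP->//|]; exact: h1.
apply: filterS H => c' H; rewrite ballEmdist /=.
exact: phiN.
Unshelve. all: by end_near. Qed.

(** A continuous injection carries compactness and the absence of isolated
points over from the Cantor space; injectivity holds because a point does not
form a scrambled pair with itself. *)
Lemma range_psi_perfect_compact :
  [/\ ~ countable (range psi), scrambled_set f (range psi),
      perfect_set (range psi) & compact (range psi)].
Proof.
have cS : compact (range psi).
  apply: continuous_compact; last exact: cantor_space_compact.
  exact/continuous_subspaceT/continuous_psi.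
split=> //.
- move=> /countable_injP[g gi]; apply: uncountable_cantor.
  apply/countable_injP; exists (g \o psi) => c c' _ _ /gi gcc'.
  by apply: psi_inj; apply: gcc'; rewrite inE; [exists c|exists c'].
- move=> _ _ [c _ <-] [c' _ <-] cc'.
  by apply: scrambled_pair_sparse => /(congr1 psi).
- have clS := compact_closed (@metric_hausdorff _ T) cS.
  split=> //; apply/seteqP; split=> x.
    by move=> /subset_limit_point; rewrite -(closure_id _).1.
  move=> [c _ <-] U /continuous_psi Uc.
  have [_ /seteqP[_ /(_ c I)]] := cantor_perfect.
  move=> /(_ _ Uc)[c' [cc' _ Uc']]; exists (psi c'); split => //.
  by apply: contra_neq cc'; exact: psi_inj.
Qed.

(** The third set is obtained from [range psi] by trading the code of the zero
sequence for the code of [1000...], which merges with it after one shift. *)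
Theorem coding_chaos :
  li_yorke_chaotic f /\
  (exists S : set T,
      [/\ ~ countable S, scrambled_set f S, perfect_set S & compact S]) /\
  (exists S : set T,
      [/\ ~ countable S, scrambled_set f S,
          ~ closed S & ~ scrambled_set f (closure S)]).
Proof.
have [uS scS pS kS] := range_psi_perfect_compact.
split; first by exists (range psi).
split; first by exists (range psi).
have [shift _ [e e0 sep]] := coding.
pose z : nat -> bool := fun=> false; pose z1 n := n == 0%N.
have psiz : psi z = phi z.
  by congr phi; apply/funext => n; rewrite /sparse; case: (mark n).
apply: (@replace_perfect_scrambled _ _ _ (range psi) (phi z) (phi z1) L) => //.
- by rewrite -psiz; exists z.
- move=> zz1; have := sep z1 z isT.
  by rewrite zz1 mdistxx leNgt e0.
- by rewrite !shift.
Qed.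

End Coding.

(** * The metric on infinite paths *)

(** Membership of the source of the first edge after [a] in [A] is what decides
whether [(a, A)] starts an infinite path beginning with [a], hence the test on
the [size a + 1] first edges. *)
Lemma initial_segment_local (G : ultragraph) (a : seq (edge G)) A g h :
  inf_paths G (Inf h) -> (forall n, (n <= size a)%N -> g n = h n) ->
  initial_segment (Fin a A) (Inf g) -> initial_segment (Fin a A) (Inf h).
Proof.
move=> hP gh [[[|e c] C|k] [_ //= Ak [gE]]].
have kE : k 0%N = h (size a) by rewrite -gh// gE /icat ltnn subnn.
exists (Inf (fun n => h (size a + n)%N)); split.
- by right=> n /=; rewrite addnS; exact: hP.
- by rewrite /= addn0 -kE.
- congr Inf; apply/funext => n; rewrite /icat; case: ltnP => na.
    by rewrite -gh ?(ltnW na)// gE /icat na; exact: set_nth_default.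
  by rewrite subnKC.
Qed.

Lemma dX_le1 (R : realType) (G : ultragraph) (p : enumeration G) (x y : X G) :
  dX R p x y <= 1.
Proof.
have [->|/eqP/(dX_neq R p)[i [_ _ ->]]] := eqVneq x y; first by rewrite dXxx.
by rewrite exprn_ile1// ?invr_ge0// invf_le1 ?ler1n.
Qed.

(** The first [M] listed paths look only at finitely many edges of an infinite
path, so two infinite paths with a long enough common beginning are separated
by none of them. *)
Lemma dX_lt_agree (R : realType) (G : ultragraph) (p : enumeration G) (e : R) :
  0 < e -> exists N, forall (x y : X G) g h, val x = Inf g -> val y = Inf h ->
    (forall n, (n < N)%N -> g n = h n) -> dX R p x y < e.
Proof.
move=> e0; have [M Me] : exists M, (2^-1 : R) ^+ M < e.
  near \oo => M; exists M; near: M.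
  have : (2^-1 : R) ^+ n @[n --> \oo] --> (0 : R).
    by apply: cvg_expr; rewrite ger0_norm ?invr_ge0// invf_lt1 ?ltr1n.
  by move=> /cvgrPdist_lt /(_ _ e0); apply: filterS => n;
    rewrite sub0r normrN ger0_norm// exprn_ge0 ?invr_ge0.
pose len (y : gpath G) := if y is Fin a _ then size a else 0%N.
pose N := (\max_(i < M) len (p i)).+1.
exists N => x y g h xE yE gh.
have [->|/eqP/(dX_neq R p)[i [si _ ->]]] := eqVneq x y; first by rewrite dXxx.
have Mi : (M <= i)%N.
  rewrite leqNgt; apply/negP => iM.
  have xP : inf_paths G (Inf g) by have := set_valP x; rewrite xE => -[//|[]].
  have yP : inf_paths G (Inf h) by have := set_valP y; rewrite yE => -[//|[]].
  move: si; rewrite /separates xE yE.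
  have := leq_bigmax (F := fun i : 'I_M => len (p i)) (Ordinal iM).
  rewrite /=; case: (p i) => [a A|?]; last by move=> _ [[]|[_ []]].
  move=> /= aN; have agh n : (n <= size a)%N -> g n = h n.
    by move=> na; apply: gh; rewrite ltnS (leq_trans na).
  case=> -[].
    by move=> /(initial_segment_local yP agh).
  by move=> + /(initial_segment_local xP (fun n na => esym (agh n na))).
apply: le_lt_trans Me; apply: ler_wiXn2l; rewrite ?invr_ge0 ?invf_le1 ?ler1n//.
exact: ltnW.
Unshelve. all: by end_near. Qed.

(** Conversely, the beginning of [g0] of length [n + 1], paired with the range
of its last edge, is one of the listed paths, and its index gives the bound. *)
Lemma dX_lt_prefix (R : realType) (G : ultragraph) (p : enumeration G)
    (g0 : nat -> edge G) n : inf_paths G (Inf g0) ->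
  exists2 e : R, 0 < e & forall (x y : X G) g h,
    val x = Inf g -> val y = Inf h -> (forall k, (k <= n)%N -> g k = g0 k) ->
    dX R p x y < e -> forall k, (k <= n)%N -> h k = g0 k.
Proof.
move=> g0P; have : range p (Fin (mkseq g0 n.+1) (rng (g0 n))).
  by rewrite enum_range; exact: fin_paths_prefix.
move=> [i _ pi]; exists (2^-1 ^+ i.+1); first by rewrite exprn_gt0// invr_gt0.
move=> x y g h xE yE gg0 xy k kn.
have gP : inf_paths G (Inf g) by have := set_valP x; rewrite xE => -[//|[]].
have pix : initial_segment (p i) (val x).
  rewrite pi xE -gg0//; suff -> : mkseq g0 n.+1 = mkseq g n.+1.
    exact: initial_segment_prefix.
  by apply/eq_in_map => j; rewrite mem_iota => /andP[_ jn]; rewrite gg0.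
have : initial_segment (p i) (val y).
  apply: contrapT => piy; have : separates (p i) (val x) (val y) by left.
  by move=> /(dX_le R); rewrite leNgt xy.
rewrite pi yE => /(@initial_segment_nth _ _ _ h h k).
by rewrite size_mkseq ltnS kn nth_mkseq// => /(_ isT).
Qed.

(** * Juxtaposing closed paths *)

(** A path from [v] back to [v] that may also visit [v] in between: unlike
[closed_paths], this is stable under concatenation. *)
Definition loop (G : ultragraph) (v : vertex G) (a : seq (edge G)) : Prop :=
  if a is e :: a' then
    [/\ path (@composable G) e a', v = src e & rng (last e a') v]
  else False.

Lemma closed_paths_loop (G : ultragraph) (v : vertex G) a :
  closed_paths v a -> loop v a.
Proof. by case: a => // e a []. Qed.

Lemma loop_cat (G : ultragraph) (v : vertex G) a b :
  loop v a -> loop v b -> loop v (a ++ b).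
Proof.
case: a => [//|e a]; case: b => [//|f b] /= [pa va la] [pb vb lb].
split=> //; last by rewrite last_cat.
by rewrite cat_path pa /= pb andbT /composable -vb; exact/mem_set.
Qed.

(** When [a] and [b] have the same length, an equality of the two words would
split into [a = b]. Otherwise, in [a ++ b] the vertex [v] is the source of the
edge at position [size a]; if say [size a < size b], then in [b ++ a] this
position is interior to the closed path [b], where [v] does not occur. Note
that [a] may be a beginning of [b], because the range of an edge can contain
[v] together with other vertices. *)
Lemma closed_paths_cat_neq (G : ultragraph) (v : vertex G) a b :
  closed_paths v a -> closed_paths v b -> a <> b -> a ++ b <> b ++ a.
Proof.
wlog ab : a b / (size a <= size b)%N => [H av bv ab|].
  case/orP: (leq_total (size a) (size b)) => /H h; first by apply: h.
  by apply/nesym; apply: h => //; exact/nesym.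
move=> av bv neq abE; move: ab; rewrite leq_eqVlt => /orP[/eqP ab|ab].
  by apply: neq; move/eqP: abE; rewrite eqseq_cat// => /andP[/eqP].
case: a b av bv {neq} abE ab => [//|e a] [//|f b] _ [_ fv _ bv] abE /=.
rewrite ltnS => ab; have := congr1 (fun s => nth f s (size (e :: a))) abE.
rewrite !nth_cat ltnn subnn /= ltnS ab => E.
have := bv (nth f b (size a)); rewrite mem_nth// -E => /(_ isT).
by rewrite fv eqxx.
Qed.

(** All blocks having the same length [L], dropping one block amounts to
shifting [L] times, whichever block it is. *)
Section Blocks.
Variables (G : ultragraph) (v : vertex G) (u : bool -> seq (edge G)) (L : nat).
Variable e0 : edge G.
Hypotheses (uL : forall b, size (u b) = L) (uv : forall b, loop v (u b)).

Definition juxtapose (w : nat -> bool) (n : nat) : edge G :=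
  nth e0 (u (w (n %/ L)%N)) (n %% L).

Lemma block_size_gt0 : (0 < L)%N.
Proof. by rewrite -(uL true); case: (u true) (uv true). Qed.

Lemma juxtapose_path w : inf_paths G (Inf (juxtapose w)).
Proof.
move=> n; rewrite /juxtapose; set b := w _.
have L0 := block_size_gt0; have := ltn_pmod n L0.
rewrite [in n.+1](divn_eq n L) -addnS divnMDl// modnMDl.
rewrite leq_eqVlt => /orP[/eqP nL|nL].
  rewrite nL divnn L0 modnn addn1.
  rewrite (_ : (n %% L)%N = (size (u b)).-1); last by rewrite uL -[in RHS]nL.
  rewrite nth_last nth0; have := uv b; have := uv (w (n %/ L).+1).
  case: (u b) => // e a; case: (u _) => // f c [_ fv _] [_ _ ea].
  by rewrite /composable /= -fv; exact/mem_set.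
rewrite (divn_small nL) addn0 (modn_small nL) -/b.
have : sorted (@composable G) (u b) by have := uv b; case: (u b) => // e a [].
by move/(sortedP e0) => /(_ (n %% L)%N); rewrite uL; exact.
Qed.

Lemma juxtapose_shift w n :
  juxtapose w (L + n) = juxtapose (fun k => w k.+1) n.
Proof.
by rewrite /juxtapose -{1 3}[L]mul1n divnMDl ?block_size_gt0// modnMDl.
Qed.

Lemma juxtapose_head w k : (k < L)%N -> juxtapose w k = nth e0 (u (w 0%N)) k.
Proof. by move=> kL; rewrite /juxtapose divn_small// modn_small. Qed.

Lemma juxtapose_agree w w' N : (forall n, (n < N)%N -> w n = w' n) ->
  forall n, (n < N)%N -> juxtapose w n = juxtapose w' n.
Proof.
move=> ww' n nN; rewrite /juxtapose ww'//.
exact: leq_ltn_trans (leq_div _ _) nN.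
Qed.

Variables (R : realType) (p : enumeration G).

Definition juxtapose_point w : shift_space R p :=
  SigSub (mem_set (or_introl (juxtapose_path w) : X G (Inf (juxtapose w)))).

Lemma val_iter_shift (x : shift_space R p) g n : val x = Inf g ->
  val (iter n (@shift_map R G p) x) = Inf (fun k => g (n + k)%N).
Proof.
move=> xE; elim: n => [|n IH]; first by rewrite xE; congr Inf.
by rewrite iterS /= IH /=; congr Inf; apply/funext => k; rewrite addSnnS.
Qed.

(** Infinite paths differing in their first block are apart because one of them
starts with [u true] and the other does not. *)
Lemma juxtapose_coding : u true <> u false ->
  shift_coding (@shift_map R G p) L juxtapose_point.
Proof.
move=> utf; split.
- move=> w; apply: val_inj; rewrite (@val_iter_shift _ (juxtapose w))//=.
  by congr Inf; apply/funext => n; exact: juxtapose_shift.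
- move=> e /(dX_lt_agree p)[N HN]; exists N => w w' ww'.
  exact: HN (juxtapose_agree ww').
- have [e e_gt0 He] := dX_lt_prefix R p L.-1 (juxtapose_path (fun=> true)).
  have H w w' : w 0%N = true -> w' 0%N = false ->
      e <= mdist (juxtapose_point w) (juxtapose_point w').
    move=> w0 w0'; rewrite leNgt; apply/negP => lt_e; apply: utf.
    apply: (@eq_from_nth _ e0); rewrite !uL// => k kL.
    have leL j : (j <= L.-1)%N = (j < L)%N.
      by rewrite -ltnS prednK// block_size_gt0.
    have := He (juxtapose_point w) (juxtapose_point w') _ _ erefl erefl _ lt_e k.
    rewrite leL !juxtapose_head// w0' => -> // j.
    by rewrite leL => jL; rewrite !juxtapose_head// w0.
  exists e => // w w'; case E: (w 0%N); case E': (w' 0%N) => // _.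
    exact: H.
  by rewrite metric_sym; exact: H.
Qed.

End Blocks.

(** * Chaos in ultragraph shift spaces *)

Lemma card_ge2_neq (T : Type) (A : set T) : (`I_2 #<= A)%card ->
  exists a b, [/\ A a, A b & a <> b].
Proof.
move=> /card_leP[f].
pose i0 : `I_2 := SigSub (mem_set (isT : `I_2 0%N)).
pose i1 : `I_2 := SigSub (mem_set (isT : `I_2 1%N)).
exists (val (f i0)), (val (f i1)); split; try exact: set_valP.
move=> /val_inj /(@inj _ _ _ f); rewrite !inE => /(_ I I) /(congr1 val).
by [].
Qed.

Theorem theorem3p9 (R : realType) (G : ultragraph) (p : enumeration G)
    (nosinks : no_sinks G)
    (hCP : exists v : vertex G, (`I_2 #<= closed_paths v)%card) :
  li_yorke_chaotic (@shift_map R G p) /\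
  (exists S : set (shift_space R p),
      [/\ ~ countable S, scrambled_set (@shift_map R G p) S,
          perfect_set S & compact S]) /\
  (exists S : set (shift_space R p),
      [/\ ~ countable S, scrambled_set (@shift_map R G p) S,
          ~ closed S & ~ scrambled_set (@shift_map R G p) (closure S)]).
Proof.
have [v /card_ge2_neq[a [b [av bv ab]]]] := hCP.
(* [a] and [b] may have different lengths, but [a ++ b] and [b ++ a] do not *)
pose u (t : bool) := if t then a ++ b else b ++ a.
have uL t : size (u t) = (size a + size b)%N.
  by case: t; rewrite /u size_cat// addnC.
have uv t : loop v (u t).
  by case: t; apply: loop_cat; exact: closed_paths_loop.
have [e0 _] : exists e0 : edge G, True.
  by case: (a) av => // e _ _; exists e.
have L0 := block_size_gt0 uL uv.
have neq : u true <> u false by exact: closed_paths_cat_neq av bv ab.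
have mdist_le1 (x y : shift_space R p) : mdist x y <= 1 by exact: dX_le1.
exact: coding_chaos L0 mdist_le1 (juxtapose_coding e0 uL uv R p neq).
Qed.
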